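(* For all $n\ge 1$, $$(-1)^{n-1}\mu_{St_n}(t)=\tilde A_{n-1}(t),$$ where $St_n$ is the star graph on $[n]$ and $\tilde A_m(t)$ is the binomial-Eulerian polynomial of degree $m$. Consequently $$(-1)^{n-1}\mu_{St_n}(1)=1+\sum_{m=1}^{n-1}(n-1)_m,$$ where $(n-1)_m=(n-1)(n-2)\cdots(n-m)$ is the falling factorial.
   Context: $[n]=\{1,\dots,n\}$, and $St_n$ is the graph on $[n]$ with edge set $\{\{1,i\}: i\in\{2,\dots,n\}\}$. The Eulerian polynomial is $A_n(t)=\sum_{\sigma\in\mathfrak S_n}t^{\mathrm{des}(\sigma)}$ with $\mathrm{des}(\sigma)=|\{i\in[n-1]:\sigma(i)>\sigma(i+1)\}|$. The binomial-Eulerian polynomial is $\tilde A_n(t)=1+t\sum_{m=1}^n\binom nm A_m(t)$ (so $\tilde A_0(t)=1$). A weighted partition of a finite set $S$ is a set $\boldsymbol{\pi}=\{B_1^{v_1},\dots,B_k^{v_k}\}$ where $\{B_1,\dots,B_k\}$ is a partition of $S$ (the underlying partition of $\boldsymbol\pi$) and each weight $v_i\in\{0,1,\dots,|B_i|-1\}$. The poset $\mathcal W\Pi_S$ consists of all weighted partitions of $S$, with $\{A_1^{w_1},\dots,A_j^{w_j}\}\le\{B_1^{v_1},\dots,B_k^{v_k}\}$ iff $\{A_1,\dots,A_j\}$ refines $\{B_1,\dots,B_k\}$ and, whenever $B_m=A_{i_1}\cup\dots\cup A_{i_l}$, one has $v_m-(w_{i_1}+\dots+w_{i_l})\in\{0,1,\dots,l-1\}$.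 For a graph $G=(V,E)$, the weighted bond poset $\mathcal W\Pi_G$ is the induced subposet of $\mathcal W\Pi_V$ consisting of weighted partitions each of whose blocks induces a connected subgraph of $G$. Its minimum element $\hat 0$ has all blocks singletons of weight $0$. For connected $G$, the maximal elements are $\{V^j\}$, $0\le j\le |V|-1$, and the Möbius polynomial of $G$ is $\mu_G(t)=\sum_{j=0}^{|V|-1}\mu_{\mathcal W\Pi_G}(\hat 0,\{V^j\})\,t^j$, where $\mu_P$ is the Möbius function of a poset $P$. *)

(* Defs.v *)
From HB Require Import structures.
From mathcomp Require Import all_boot all_order all_fingroup all_algebra.

Set Implicit Arguments.
Unset Strict Implicit.
Unset Printing Implicit Defensive.

Import Order.TTheory GRing.Theory Num.Theory.

(** * Finite simple graphs *)

Record sgraph (T : finType) := SGraph {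
  adj :> rel T;
  adj_sym : symmetric adj;
  adj_irr : irreflexive adj }.

(* The subgraph of G induced by B is connected (vacuous for B = set0). *)
Definition induces_connected (T : finType) (G : sgraph T) (B : {set T}) : bool :=
  [forall x in B, forall y in B,
     connect [rel u v | [&& u \in B, v \in B & adj G u v]] x y].

Definition connected_graph (T : finType) (G : sgraph T) : bool :=
  (0 < #|T|) && induces_connected G [set: T].

(* The star on 'I_n: the vertex i of [n] is the ordinal i - 1, so the centre
   is the ordinal 0. *)
Definition star_adj (n : nat) : rel 'I_n :=
  fun i j => (i != j) && ((i == 0 :> nat) || (j == 0 :> nat)).

Lemma star_adj_sym n : symmetric (@star_adj n).
Proof. by move=> i j; rewrite /star_adj eq_sym orbC. Qed.

Lemma star_adj_irr n : irreflexive (@star_adj n).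
Proof. by move=> i; rewrite /star_adj eqxx. Qed.

Definition star (n : nat) : sgraph 'I_n := SGraph (@star_adj_sym n) (@star_adj_irr n).

Lemma star_connected (n : nat) : 0 < n -> connected_graph (star n).
Proof.
case: n => // n _; rewrite /connected_graph card_ord /=.
pose V := [set: 'I_n.+1].
pose e : rel 'I_n.+1 := [rel u v | [&& u \in V, v \in V & star_adj u v]].
have H0 x y : (x == ord0) || (y == ord0) -> connect e x y.
  have [->|nxy] := eqVneq x y; first by rewrite connect0.
  by move=> h; apply: connect1; rewrite /e /= !in_setT /star_adj nxy.
apply/forall_inP => x _; apply/forall_inP => y _.
by apply: (@connect_trans _ e ord0); apply: H0; rewrite eqxx ?orbT.
Qed.

(** * The poset of weighted partitions of T *)

(* A weighted block B^v is the pair (B, v).  The bound 'I_#|T|.+1 only serves to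
   make the type finite: weights are required to satisfy v < #|B|. *)
Definition wblock (T : finType) : finType := ({set T} * 'I_#|T|.+1)%type.

Definition underlying (T : finType) (p : {set wblock T}) : {set {set T}} :=
  [set b.1 | b in p].

Definition is_wpart (T : finType) (p : {set wblock T}) : bool :=
  [&& partition (underlying p) [set: T],
      [forall b in p, forall c in p, (b.1 == c.1) ==> (b == c)] &
      [forall b in p, b.2 < #|b.1|]].

Record wpart (T : finType) :=
  WPart { wblocks :> {set wblock T}; wpartP : is_wpart wblocks }.

HB.instance Definition _ (T : finType) := [isSub for @wblocks T].
HB.instance Definition _ (T : finType) := [Finite of wpart T by <:].

Definition refines (T : finType) (P Q : {set {set T}}) : bool :=
  [forall A in P, exists B in Q, A \subset B].

(* The number of blocks of p contained in B, and the sum of their weights. *)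
Definition nblocks_in (T : finType) (p : {set wblock T}) (B : {set T}) : nat :=
  #|[set a in p | a.1 \subset B]|.

Definition weight_in (T : finType) (p : {set wblock T}) (B : {set T}) : nat :=
  \sum_(a in p | a.1 \subset B) a.2.

(* The second conjunct says v - (w_1 + ... + w_l) \in {0, ..., l - 1}; the
   subtraction is exact because of the first inequality. *)
Definition wpart_le (T : finType) (p q : wpart T) : bool :=
  refines (underlying p) (underlying q) &&
  [forall b in (q : {set _}),
     (weight_in p b.1 <= b.2) && (b.2 - weight_in p b.1 < nblocks_in p b.1)].

Section WPartOrder.
Variable T : finType.
Implicit Types p q r : wpart T.

Lemma wpart_uniq p b c (x : T) :
  b \in wblocks p -> c \in wblocks p -> x \in b.1 -> x \in c.1 -> b = c.
Proof.
case: p => p /= /and3P[/and3P[_ /trivIsetP tI _] /forall_inP inj _] bp cp xb xc.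
apply/eqP; move/forall_inP: (inj _ bp) => /(_ _ cp) /implyP; apply.
apply: contraT => nbc.
have /pred0P/(_ x) := tI _ _ (imset_f _ bp) (imset_f _ cp) nbc.
by rewrite /= xb xc.
Qed.

Lemma wpart_lt p b : b \in wblocks p -> b.2 < #|b.1|.
Proof. by case: p => p /= /and3P[_ _ /forall_inP] h /h. Qed.

Lemma wpart_ex p b : b \in wblocks p -> exists x, x \in b.1.
Proof.
by move=> /wpart_lt h; apply/card_gt0P; apply: leq_ltn_trans h.
Qed.

Lemma wpart_cover p (x : T) : exists2 b, b \in wblocks p & x \in b.1.
Proof.
case: p => p /= /and3P[/and3P[/eqP cov _ _] _ _].
have: x \in cover (underlying p) by rewrite cov inE.
by case/bigcupP => B /imsetP[b bp ->] xb; exists b.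
Qed.

Lemma wpart_leP p q : reflect
  ((forall a, a \in wblocks p -> exists2 b, b \in wblocks q & a.1 \subset b.1) /\
   (forall b, b \in wblocks q -> weight_in p b.1 <= b.2 < weight_in p b.1 + nblocks_in p b.1))
  (wpart_le p q).
Proof.
apply: (iffP andP) => -[H1 H2]; split.
- move=> a ap; move/forall_inP/(_ _ (imset_f _ ap)): H1.
  by case/exists_inP => B /imsetP[b bq ->]; exists b.
- move=> b bq; move/forall_inP/(_ _ bq)/andP: H2 => [h1].
  by rewrite h1 ltn_subLR.
- apply/forall_inP => A /imsetP[a ap ->]; have [b bq ab] := H1 _ ap.
  by apply/exists_inP; exists b.1; rewrite ?imset_f.
- apply/forall_inP => b bq; have /andP[h1 h2] := H2 _ bq.
  by rewrite h1 ltn_subLR.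
Qed.

Lemma wpart_le_refl : reflexive (@wpart_le T).
Proof.
move=> p; apply/wpart_leP; split=> [a ap|b bp]; first by exists a.
have eqb : forall a, (a \in wblocks p) && (a.1 \subset b.1) = (a == b).
  move=> a; apply/andP/eqP => [[ap sab]|->//].
  have [x xa] := wpart_ex ap; apply: (wpart_uniq ap bp xa).
  exact: (subsetP sab).
rewrite /weight_in /nblocks_in (eq_bigl _ _ eqb) big_pred1_eq.
by rewrite (eq_card (B := pred1 b)) ?card1 ?leqnn ?addn1 ?ltnSn // => a; rewrite inE eqb.
Qed.

Lemma wpart_le_anti_sub p q :
  wpart_le p q -> wpart_le q p -> wblocks q \subset wblocks p.
Proof.
move=> /wpart_leP[pq wpq] /wpart_leP[qp _]; apply/subsetP => b bq.
have [a ap sba] := qp _ bq; have [b' b'q sab'] := pq _ ap.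
have [x xb] := wpart_ex bq.
have xa := subsetP sba _ xb; have xb' := subsetP sab' _ xa.
have eb := wpart_uniq bq b'q xb xb'; subst b'.
have ab1 : a.1 = b.1 by apply/eqP; rewrite eqEsubset sab' sba.
have eqa : forall c, (c \in wblocks p) && (c.1 \subset b.1) = (c == a).
  move=> c; apply/andP/eqP => [[cp scb]|->]; last by rewrite ap.
  have [y yc] := wpart_ex cp; apply: (wpart_uniq cp ap yc).
  by rewrite ab1; apply: (subsetP scb).
have := wpq _ bq; rewrite /weight_in /nblocks_in (eq_bigl _ _ eqa) big_pred1_eq.
rewrite (eq_card (B := pred1 a)) => [|c]; last by rewrite inE eqa.
rewrite card1 addn1 ltnS -eqn_leq => /eqP /val_inj ab2.
by case: a b ab1 ab2 ap {pq wpq qp sba sab' bq b'q xb xa xb' eqa} => [A v] [B w] /= -> ->.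
Qed.

Lemma wpart_le_anti : antisymmetric (@wpart_le T).
Proof.
move=> p q /andP[pq qp]; apply: val_inj; apply/eqP.
by rewrite eqEsubset !wpart_le_anti_sub.
Qed.

Lemma wpart_big_refine p q r (c : wblock T) (F : wblock T -> nat) :
  wpart_le p q -> wpart_le q r -> c \in wblocks r ->
  \sum_(a in wblocks p | a.1 \subset c.1) F a =
  \sum_(b in wblocks q | b.1 \subset c.1) \sum_(a in wblocks p | a.1 \subset b.1) F a.
Proof.
move=> /wpart_leP[pq _] /wpart_leP[qr _] cr.
rewrite (exchange_big_dep (fun a => (a \in wblocks p) && (a.1 \subset c.1))) /=.
  apply: eq_bigr => a /andP[ap sac].
  have [b bq sab] := pq _ ap; have [c' c'r sbc'] := qr _ bq.
  have [x xa] := wpart_ex ap.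
  have xc' := subsetP sbc' _ (subsetP sab _ xa).
  have ec := wpart_uniq c'r cr xc' (subsetP sac _ xa); subst c'.
  rewrite (big_pred1 b) // => b' /=; apply/idP/eqP => [|->]; last first.
    by rewrite bq sbc' ap sab.
  case/andP => /andP[b'q _] /andP[_ sab'].
  exact: (wpart_uniq b'q bq (subsetP sab' _ xa) (subsetP sab _ xa)).
by move=> b a /andP[_ sbc] /andP[-> sab]; apply: subset_trans sbc.
Qed.

Lemma wpart_le_trans : transitive (@wpart_le T).
Proof.
move=> q p r pq qr; move/wpart_leP: (pq) => [pq1 pq2].
move/wpart_leP: (qr) => [qr1 qr2]; apply/wpart_leP; split.
  move=> a /pq1[b bq sab]; have [c cr sbc] := qr1 _ bq.
  by exists c => //; apply: subset_trans sbc.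
move=> c cr; have nE s (B : {set T}) : nblocks_in s B = \sum_(a in s | a.1 \subset B) 1.
  by rewrite /nblocks_in -sum1_card; apply: eq_bigl => a; rewrite inE.
rewrite /weight_in nE !(wpart_big_refine _ pq qr cr).
have /andP[h1 h2] := qr2 _ cr; apply/andP; split.
  apply: leq_trans h1; apply: leq_sum => b /andP[bq _].
  by have /andP[] := pq2 _ bq.
apply: leq_trans h2 _; rewrite nE -!big_split /=.
apply: leq_sum => b /andP[bq _]; have /andP[_] := pq2 _ bq.
by rewrite addn1 nE.
Qed.

End WPartOrder.

Fact wpart_display : Order.disp_t. Proof. exact: Order.Disp tt tt. Qed.

HB.instance Definition _ (T : finType) :=
  Order.Le_isPOrder.Build wpart_display (wpart T)
    (@wpart_le_refl T) (@wpart_le_anti T) (@wpart_le_trans T).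

(** * The weighted bond poset of a graph *)

Definition is_wbond (T : finType) (G : sgraph T) (p : wpart T) : bool :=
  [forall b in (p : {set _}), induces_connected G b.1].

Record wbond (T : finType) (G : sgraph T) :=
  WBond { wbond_part :> wpart T; wbondP : is_wbond G wbond_part }.

HB.instance Definition _ (T : finType) (G : sgraph T) := [isSub for @wbond_part T G].
HB.instance Definition _ (T : finType) (G : sgraph T) := [Finite of wbond G by <:].
HB.instance Definition _ (T : finType) (G : sgraph T) :=
  [SubChoice_isSubPOrder of wbond G by <: with wpart_display].

Definition bot_blocks (T : finType) : {set wblock T} :=
  [set ([set x], ord0) | x : T].

Lemma bot_is_wpart (T : finType) : is_wpart (bot_blocks T).
Proof.
have mem (b : wblock T) : b \in bot_blocks T -> exists x, b = ([set x], ord0).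
  by case/imsetP => x _ ->; exists x.
apply/and3P; split.
- apply/and3P; split.
  + apply/eqP/setP => x; rewrite inE; apply/bigcupP; exists [set x]; last exact: set11.
    by apply/imsetP; exists ([set x], ord0); rewrite // imset_f.
  + apply/trivIsetP => A B /imsetP[a /mem[x ->] ->] /imsetP[b /mem[y ->] ->] /=.
    by rewrite disjoints1 inE; apply: contraNN => /eqP->.
  + by apply/imsetP => -[b /mem[x ->]] /setP/(_ x); rewrite !inE eqxx.
- apply/forall_inP => b /mem[x ->]; apply/forall_inP => c /mem[y ->] /=.
  by apply/implyP => /eqP->.
- by apply/forall_inP => b /mem[x ->] /=; rewrite cards1.
Qed.

Lemma bot_is_wbond (T : finType) (G : sgraph T) : is_wbond G (WPart (bot_is_wpart T)).
Proof.
apply/forall_inP => b /imsetP[x _ ->] /=.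
apply/forall_inP => y; rewrite inE => /eqP->.
by apply/forall_inP => z; rewrite inE => /eqP->; rewrite connect0.
Qed.

Definition wbond_bot (T : finType) (G : sgraph T) : wbond G :=
  WBond (bot_is_wbond G).

Lemma wbond_bot_le (T : finType) (G : sgraph T) (p : wbond G) :
  (wbond_bot G <= p)%O.
Proof.
change (wpart_le (WPart (bot_is_wpart T)) p); apply/wpart_leP; split.
  move=> a /imsetP[x _ ->] /=; have [b bp xb] := wpart_cover p x.
  by exists b; rewrite ?sub1set.
move=> b bp; rewrite /weight_in big1 /=; last by move=> a /andP[/imsetP[x _ ->]].
have -> : nblocks_in (bot_blocks T) b.1 = #|b.1|; last exact: wpart_lt bp.
have inj : injective (fun x : T => ([set x], ord0) : wblock T).
  by move=> x y [] /set1_inj.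
rewrite -(card_imset (mem b.1) inj); apply: eq_card => a; rewrite !inE.
apply/andP/imsetP => [[/imsetP[x _ ->]]|[x xb ->]] /=.
  by rewrite sub1set => xb; exists x.
by rewrite sub1set imset_f.
Qed.

(* V^j, for j <= #|V| - 1. *)
Definition top_blocks (T : finType) (j : 'I_#|T|) : {set wblock T} :=
  [set ([set: T], widen_ord (leqnSn #|T|) j)].

Lemma top_is_wpart (T : finType) (j : 'I_#|T|) : is_wpart (top_blocks j).
Proof.
have Tgt0 : 0 < #|T| by apply: leq_ltn_trans (ltn_ord j).
apply/and3P; split.
- rewrite /underlying imset_set1; apply/and3P; split.
  + by rewrite /cover big_set1.
  + by apply/trivIsetP => A B; rewrite !inE => /eqP-> /eqP->; rewrite eqxx.
  + by rewrite inE eq_sym -cards_eq0 cardsT -lt0n.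
- apply/forall_inP => b; rewrite inE => /eqP->; apply/forall_inP => c.
  by rewrite inE => /eqP->; apply/implyP.
- by apply/forall_inP => b; rewrite inE => /eqP-> /=; rewrite cardsT.
Qed.

Lemma top_is_wbond (T : finType) (G : sgraph T) (cG : connected_graph G)
  (j : 'I_#|T|) : is_wbond G (WPart (top_is_wpart j)).
Proof.
by apply/forall_inP => b; rewrite inE => /eqP->; case/andP: cG.
Qed.

Definition wbond_top (T : finType) (G : sgraph T) (cG : connected_graph G)
  (j : 'I_#|T|) : wbond G := WBond (top_is_wbond cG j).

(** * Moebius functions and polynomials *)

Local Open Scope ring_scope.

(* The recursion mu(x, x) = 1, mu(x, y) = - \sum_(x <= z < y) mu(x, z) for x < y
   (and mu(x, y) = 0 if x is not below y), run with enough fuel: see mobiusE. *)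
Fixpoint mobius_rec (d : Order.disp_t) (P : finPOrderType d) (k : nat) (x y : P) : int :=
  if x == y then 1 else
  if k is k'.+1 then
    if (x < y)%O then - \sum_(z : P | (x <= z)%O && (z < y)%O) mobius_rec k' x z else 0
  else 0.

Definition mobius (d : Order.disp_t) (P : finPOrderType d) (x y : P) : int :=
  mobius_rec #|P| x y.

Lemma mobiusE (d : Order.disp_t) (P : finPOrderType d) (x y : P) :
  mobius x y =
  if x == y then 1 else
  if (x < y)%O then - \sum_(z : P | (x <= z)%O && (z < y)%O) mobius x z else 0.
Proof.
have fuel k : forall l z,
    (#|[pred w | (w < z)%O]| <= k)%N -> (#|[pred w | (w < z)%O]| <= l)%N ->
    mobius_rec k x z = mobius_rec l x z.
  have small z : (#|[pred w | (w < z)%O]| <= 0)%N -> (x < z)%O = false.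
    by rewrite leqn0 => /eqP/card0_eq/(_ x); rewrite inE.
  elim: k => [|k IH] [|l] z hk hl //=; case: eqP => // _.
  - by rewrite small.
  - by rewrite small.
  case: ifP => // _; congr (- _); apply: eq_bigr => w /andP[_ wz].
  have lt_card : (#|[pred v | (v < w)%O]| < #|[pred v | (v < z)%O]|)%N.
    apply: proper_card; apply/properP; split.
      by apply/subsetP => v; rewrite !inE => /lt_trans; apply.
    by exists w; rewrite !inE ?ltxx.
  by apply: IH; rewrite -ltnS; apply: leq_trans lt_card _.
have P0 : (0 < #|P|)%N by apply/card_gt0P; exists x.
rewrite /mobius -[in LHS](prednK P0) /=; case: eqP => // _; case: ifP => // _.
congr (- _); apply: eq_bigr => z /andP[_ zy]; apply: fuel; last exact: max_card.
rewrite -ltnS (prednK P0); apply: proper_card; apply/properP; split; first exact: subset_predT.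
by exists z => //; rewrite inE ltxx.
Qed.

Definition mobius_poly (T : finType) (G : sgraph T) (cG : connected_graph G) : {poly int} :=
  \sum_(j < #|T|) mobius (wbond_bot G) (wbond_top cG j) *: 'X^j.

(** * Eulerian and binomial-Eulerian polynomials *)

(* Positions and values are shifted by one: i ranges over those i : 'I_n that
   have a successor in 'I_n. *)
Definition des (n : nat) (s : 'S_n) : nat :=
  #|[set i : 'I_n | [exists j : 'I_n, (j == i.+1 :> nat) && (s j < s i)%N]]|.

Definition eulerian_poly (n : nat) : {poly int} := \sum_(s : 'S_n) 'X^(des s).

Definition binom_eulerian_poly (n : nat) : {poly int} :=
  1 + 'X * \sum_(1 <= m < n.+1) (eulerian_poly m *+ 'C(n, m)).

(* Main.v *)
(* A bond of the star is determined by its central block: every other block is a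
   leaf of weight 0.  With (S, v) the set of leaves and the weight of the central
   block, (S, v) <= (S', v') iff S is contained in S' and 0 <= v' - v <= |S' \ S|.
   Hence the polynomials M_k(t) collecting the Moebius values of the (S, v) with
   |S| = k are determined by
     \sum_j C(k, j) M_j(t) (1 + t + ... + t^(k - j)) = [k = 0],
   and it suffices that (-1)^j A~_j(t) satisfies the same relations.  This follows,
   by binomial inversion, from
     A_k(t) = (1 - t)^(k + 1) + t \sum_m C(k, m) A_m(t) (1 - t)^(k - m),
   which is proved by induction on k from the recurrence
     A_(k + 1) = (1 + k t) A_k + t (1 - t) A_k'. *)
Require Import Defs.
From mathcomp Require Import all_boot all_order all_fingroup all_algebra.
From mathcomp Require Import zify ring.
Import Order.TTheory GRing.Theory.
Local Open Scope ring_scope.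

Set Implicit Arguments.
Unset Strict Implicit.
Unset Printing Implicit Defensive.

(** * Eulerian polynomials *)

Lemma desE (N : nat) (s : 'S_N.+1) :
  des s = (\sum_(k < N) (s (inord k.+1) < s (inord k)))%N.
Proof.
rewrite /des -sum1_card big_mkcond /= big_ord_recr /= [X in (_ + X)%N](_ : _ = 0%N).
  rewrite addn0; apply: eq_bigr => k _; rewrite inE.
  have -> : widen_ord (leqnSn N) k = inord k.
    by apply: val_inj; rewrite /= inordK // ltnS; apply/ltnW.
  rewrite inordK; last by rewrite ltnS; apply/ltnW.
  have -> : [exists j : 'I_N.+1, (j == k.+1 :> nat) && (s j < s (inord k))%N]
            = (s (inord k.+1) < s (inord k))%N.
    apply/existsP/idP => [[j /andP[/eqP jk]]|h].
      by have -> // : j = inord k.+1; apply: val_inj; rewrite /= inordK -jk.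
    by exists (inord k.+1); rewrite inordK ?ltnS ?ltn_ord // eqxx.
  by case: (_ < _)%N.
rewrite inE; case: existsP => // -[j /andP[/eqP jN _]].
by have := ltn_ord j; rewrite jN ltnn.
Qed.

(** The word [w'] is [w] with a dominating letter [M] inserted at position [i]. This letter never
    ends a descent, starts one unless it is last, and separates [w i.-1] from [w i]. The lost
    descent is added on the left to avoid truncated subtraction. Induction peels off the last
    comparison. *)
Lemma insert_max_descents (N i M : nat) (w w' : nat -> nat) :
  (i <= N.+1)%N -> (forall k, (k <= N)%N -> (w k < M)%N) ->
  (forall k, (k <= N.+1)%N ->
     w' k = if (k < i)%N then w k else if k == i then M else w k.-1) ->
  (\sum_(k < N.+1) (w' k.+1 < w' k) + ((0 < i <= N) && (w i < w i.-1)) =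
   \sum_(k < N) (w k.+1 < w k) + (i <= N))%N.
Proof.
elim: N i => [|N IH] i iN wM Ew'.
  rewrite big_ord_recr !big_ord0 /= !Ew' //; have := wM 0%N isT.
  by case: i iN {Ew'} => [|[|i]] //=; lia.
have [ei|niN] := eqVneq i N.+2.
  rewrite {}ei in iN Ew' *.
  rewrite ltnn andbF !addn0 big_ord_recr /= !Ew' // ltnn eqxx (ltnSn N.+1).
  have := wM N.+1 (leqnn _).
  have -> : (\sum_(k < N.+1) (w' k.+1 < w' k) = \sum_(k < N.+1) (w k.+1 < w k))%N.
    by apply: eq_bigr => k _; have := ltn_ord k => kN; rewrite !Ew'; do ?case: ifP; try lia.
  by move=> h; rewrite ltnNge (ltnW h) addn0.
have iN1 : (i <= N.+1)%N by lia.
have wM1 k : (k <= N)%N -> (w k < M)%N by move=> kN; apply: wM; lia.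
have Ew1 k : (k <= N.+1)%N ->
    w' k = if (k < i)%N then w k else if k == i then M else w k.-1.
  by move=> kN; apply: Ew'; lia.
move/(_ i iN1 wM1 Ew1): IH => IH.
rewrite big_ord_recr [in RHS]big_ord_recr /=.
rewrite (Ew' N.+2) ?(Ew' N.+1) //; have := wM N.+1 (leqnn _).
move=> h; move: IH; have [iN2|iN2] := leqP i N.
  have -> : (N.+2 < i = false)%N by lia.
  have -> : (N.+1 < i = false)%N by lia.
  have -> : (N.+2 == i = false)%N by lia.
  have -> : (i <= N.+1)%N by lia.
  have -> : (N.+1 == i = false)%N by lia.
  rewrite andbT => E; rewrite -addnA [X in (_ + X)%N]addnC addnA {}E.
  by rewrite addnAC.
(* [M] is now the next to last letter: the last comparison of [w'] is a descent, and the induction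
   hypothesis sees [M] at the end of the shortened word. *)
have -> : i = N.+1 by lia.
rewrite !ltnn (ltnNge N.+2) leqnSn !eqxx; have -> : (N.+2 == N.+1 = false)%N by lia.
rewrite /= h ltnSn !addn0 => ->.
by rewrite addnAC.
Qed.

Lemma eulerian_poly0 : eulerian_poly 0 = 1.
Proof.
rewrite /eulerian_poly (big_pred1 1%g) => [|s]; last first.
  by apply/esym/eqP/permP => -[].
rewrite /des eq_card0 ?expr0 // => -[]//.
Qed.

(** The first component is the position of the maximum, so it can be read off; injectivity then
    suffices because [(n + 1) n! = (n + 1)!]. *)
Lemma lift_perm_max_bij (n : nat) :
  bijective (fun p : 'I_n.+1 * 'S_n => lift_perm p.1 ord_max p.2).
Proof.
apply: inj_card_bij => [[i s] [j u] /= E|]; last first.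
  by rewrite card_prod card_ord !card_Sn factS.
have ij : i = j.
  by apply: (@perm_inj _ (lift_perm i ord_max s)); rewrite {2}E !lift_perm_id.
rewrite -ij in E *; congr (_, _); apply/permP => k.
by apply: (@lift_inj _ ord_max); rewrite -!(lift_perm_lift i) E.
Qed.

Lemma des_insert_max (N : nat) (i : 'I_N.+2) (s : 'S_N.+1) :
  (des (lift_perm i ord_max s) +
     ((0 < i <= N) && (s (inord i) < s (inord i.-1))) = des s + (i <= N))%N.
Proof.
rewrite !desE; set w := fun k : nat => nat_of_ord (s (inord k)).
set w' := fun k : nat => nat_of_ord (lift_perm i ord_max s (inord k)).
apply: (@insert_max_descents N i N.+1 w w') => [|k _|k kN]; first exact: leq_ord.
  exact: ltn_ord.
(* The positions other than [i] are exactly the values of [bump i]. *)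
have lift_at j : (j <= N)%N -> w' (bump i j) = w j.
  move=> jN; rewrite /w' (_ : inord _ = lift i (inord j : 'I_N.+1)).
    by rewrite lift_perm_lift lift_max.
  by apply: val_inj; rewrite /= !inordK //= /bump; lia.
have ik := leq_ord i.
case: ltngtP => [ki|ik'|->].
- by rewrite -(lift_at k) ?/bump; [congr w'; lia | lia].
- by rewrite -(lift_at k.-1) ?/bump; [congr w'; lia | lia].
- by rewrite /w' inord_val lift_perm_id.
Qed.

Lemma eulerian_poly1 : eulerian_poly 1 = 1.
Proof.
rewrite /eulerian_poly (big_pred1 1%g) => [|s]; last first.
  by apply/esym/eqP/permP => i; apply/val_inj; rewrite !(ord1 _).
by rewrite desE big_ord0.
Qed.

(* Inserting the maximum at the end or inside a descent of [s] keeps [des s];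
   each of the other [n - des s] positions adds one descent. *)
Lemma eulerian_polyS (n : nat) :
  eulerian_poly n.+1 =
  (1 + 'X *+ n) * eulerian_poly n + 'X * (1 - 'X) * (eulerian_poly n)^`().
Proof.
case: n => [|N].
  by rewrite eulerian_poly0 eulerian_poly1 derivC mulr0 addr0 mulr0n addr0 mulr1.
rewrite {1}/eulerian_poly (reindex _ (onW_bij _ (lift_perm_max_bij N.+1))) /=.
rewrite -(pair_bigA _ (fun i s => 'X^(des (lift_perm i ord_max s)))) exchange_big /=.
rewrite /eulerian_poly raddf_sum !mulr_sumr -big_split /=; apply: eq_bigr => s _.
set d := des s.
have mid (j : 'I_N) : 'X^(des (lift_perm (lift ord0 (widen_ord (leqnSn N) j)) ord_max s))
   = 'X^(d.+1) + ('X^d - 'X^(d.+1)) *+ (s (inord j.+1) < s (inord j)) :> {poly int}.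
  have := des_insert_max (lift ord0 (widen_ord (leqnSn N) j)) s.
  rewrite /= /bump add1n ltn_ord /= -/d; case: (_ < _)%N; rewrite ?addn0 ?addn1.
    by move=> /succn_inj ->; rewrite mulr1n addrC subrK.
  by move=> ->; rewrite mulr0n addr0.
have desmin : des (lift_perm ord0 ord_max s) = d.+1.
  by have := des_insert_max ord0 s; rewrite /= addn0 addn1.
have desmax : des (lift_perm (lift ord0 ord_max) ord_max s) = d.
  by have := des_insert_max (lift ord0 ord_max) s; rewrite /= /bump add1n ltnn !addn0.
rewrite big_ord_recl big_ord_recr /= desmin desmax (eq_bigr _ (fun j _ => mid j)).
rewrite big_split /= sumr_const card_ord sumrMnr -desE -/d derivXn.
(* The truncation of [d.-1] at [d = 0] is harmless: the multiplicity [d] vanishes there. *)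
have -> : 'X * (1 - 'X) * ('X^(d.-1) *+ d) = (1 - 'X) * 'X^d *+ d :> {poly int}.
  by case: d {mid desmin desmax} => [|e]; rewrite ?mulr0 // exprS; ring.
rewrite exprS; ring.
Qed.

(** * Binomial transforms and the binomial-Eulerian polynomials *)

(* On exponential generating functions in z this is multiplication by e^(x z). *)
Definition binom_transform (R : pzRingType) (x : R) (b : nat -> R) (k : nat) : R :=
  \sum_(m < k.+1) (b m * x ^+ (k - m)) *+ 'C(k, m).

Section BinomTransform.
Variable R : comNzRingType.
Implicit Types (x y : R) (b : nat -> R).

Lemma eq_binom_transform x b c k : b =1 c -> binom_transform x b k = binom_transform x c k.
Proof. by move=> bc; apply: eq_bigr => m _; rewrite bc. Qed.

(** The product rule for [e^(x z) b(z)]: shifting a sequence differentiates its exponential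
    generating function. *)
Lemma binom_transformS x b k :
  binom_transform x b k.+1 =
  binom_transform x (fun m => b m.+1) k + x * binom_transform x b k.
Proof.
rewrite /binom_transform big_ord_recl /= subn0 bin0 mulr1n.
under eq_bigr => m _ do rewrite /bump add1n subSS binS mulrnDr.
rewrite big_split /= addrA addrC; congr (_ + _).
rewrite [in LHS]big_ord_recr /= bin_small // mulr0n addr0.
rewrite [in RHS]big_ord_recl /= bin0 mulr1n subn0 mulrDr; congr (_ + _).
  by rewrite exprS; ring.
rewrite mulr_sumr; apply: eq_bigr => m _.
by rewrite /bump add1n -(subnSK (ltn_ord m)) exprS mulrnAr; congr (_ *+ _); ring.
Qed.

Lemma binom_transformD x b c k :
  binom_transform x (fun m => b m + c m) k = binom_transform x b k + binom_transform x c k.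
Proof.
by rewrite /binom_transform -big_split; apply: eq_bigr => m _; rewrite mulrDl mulrnDl.
Qed.

Lemma binom_transformZ x a b k :
  binom_transform x (fun m => a * b m) k = a * binom_transform x b k.
Proof.
by rewrite /binom_transform mulr_sumr; apply: eq_bigr => m _; rewrite -mulrA mulrnAr.
Qed.

(** This is [e^(x z) e^(y z) = e^((x + y) z)]. The induction is over all [b], since the product rule
    shifts the sequence. *)
Lemma binom_transform_comp x y b k :
  binom_transform x (binom_transform y b) k = binom_transform (x + y) b k.
Proof.
elim: k b => [|k IH] b; first by rewrite /binom_transform !big_ord1 /= !mulr1 mulr1n.
rewrite !binom_transformS (eq_binom_transform _ _ (binom_transformS y b)).
by rewrite binom_transformD binom_transformZ !IH; ring.
Qed.

Lemma binom_transform0 b k : binom_transform 0 b k = b k.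
Proof.
rewrite /binom_transform big_ord_recr /= subnn mulr1 binn mulr1n big1 ?add0r // => m _.
by rewrite expr0n subn_eq0 leqNgt ltn_ord mulr0 mul0rn.
Qed.

Lemma binom_transform_delta x k : binom_transform x (fun m => (m == 0)%:R) k = x ^+ k.
Proof.
rewrite /binom_transform big_ord_recl /= big1 ?addr0 => [|m _]; last by rewrite mul0r mul0rn.
by rewrite mul1r subn0 bin0.
Qed.

(** The substitution of [-z] for [z] in the generating functions. *)
Lemma binom_transform_sign x b k :
  (-1) ^+ k * binom_transform x b k = binom_transform (- x) (fun m => (-1) ^+ m * b m) k.
Proof.
rewrite /binom_transform mulr_sumr; apply: eq_bigr => m _.
have mk : (m <= k)%N by rewrite -ltnS.
have -> : (-1) ^+ k = (-1) ^+ m * (-1) ^+ (k - m) :> R by rewrite -exprD subnKC.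
by rewrite mulrnAr [(- x) ^+ _]exprNn; congr (_ *+ _); ring.
Qed.

End BinomTransform.

(** In generating functions, [A(z) = (1 - t) e^((1 - t) z) + t e^((1 - t) z) A(z)]: Euler's formula
    for [A(z)] with its denominator cleared. *)
Lemma eulerian_poly_binom (k : nat) :
  eulerian_poly k =
  (1 - 'X) ^+ k.+1 + 'X * binom_transform (1 - 'X) eulerian_poly k.
Proof.
elim: k => [|k IH].
  by rewrite /binom_transform big_ord1 /= eulerian_poly0 expr1 mulr1n !mulr1 subrK.
(* Applying [t (1 - t) d/dt] to [(1 - t)^(k - m)] multiplies it by [-(k - m) t], which turns the
   factor [1 + m t] of each recurrence into the common [1 + k t]. *)
have deriv_T : 'X * (1 - 'X) * (binom_transform (1 - 'X) eulerian_poly k)^`() =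
    binom_transform (1 - 'X) (fun m => eulerian_poly m.+1) k
    - (1 + 'X *+ k) * binom_transform (1 - 'X) eulerian_poly k.
  rewrite /binom_transform raddf_sum /= !mulr_sumr -sumrB; apply: eq_bigr => m _.
  rewrite derivMn !mulrnAr -mulrnBl; congr (_ *+ _).
  have mk : (m <= k)%N by rewrite -ltnS.
  rewrite derivM deriv_exp derivB derivX derivC sub0r eulerian_polyS.
  have -> : (1 + 'X *+ k) = (1 + 'X *+ m) + 'X *+ (k - m) :> {poly int}.
    by rewrite -addrA -mulrnDr subnKC.
  case: (k - m)%N => [|e]; first by rewrite expr0; ring.
  by rewrite [(1 - 'X) ^+ e.+1]exprS; ring.
rewrite eulerian_polyS {1 2}IH derivD derivM derivX deriv_exp derivB derivX derivC /=.
rewrite binom_transformS [(1 - 'X) ^+ k.+2]exprS.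
move: deriv_T; set T := binom_transform _ eulerian_poly k.
set U := binom_transform _ _ k => E.
have {E} -> : U = 'X * (1 - 'X) * T^`() + (1 + 'X *+ k) * T by rewrite E subrK.
by rewrite [(1 - 'X) ^+ k.+1]exprS; ring.
Qed.

(** The correction at [m = 0] makes that entry [(1 - t) + t = 1], the constant term outside the
    sum. *)
Lemma binom_eulerian_transform k :
  binom_eulerian_poly k =
  binom_transform 1 (fun m => (1 - 'X) * (m == 0)%:R + 'X * eulerian_poly m) k.
Proof.
rewrite /binom_eulerian_poly /binom_transform big_ord_recl /= eulerian_poly0 bin0.
rewrite expr1n !mulr1 subrK; congr (_ + _).
rewrite big_add1 /= big_mkord mulr_sumr; apply: eq_bigr => m _.
by rewrite mulr0 add0r expr1n mulr1 mulrnAr.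
Qed.

(** Multiplied by [1 - t], the geometric sum becomes [1 - t t^(k - j)], so the left side is a
    difference of transforms at 1 and at [t]. The signed sequence is itself a transform at -1;
    composing leaves transforms at 0 and at [t - 1], the latter given by [eulerian_poly_binom]. *)
Lemma binom_eulerian_inversion k :
  \sum_(j < k.+1) ((-1) ^+ j * binom_eulerian_poly j * \poly_(l < (k - j).+1) 1) *+ 'C(k, j)
  = (k == 0)%:R.
Proof.
pose b m : {poly int} := (1 - 'X) * (m == 0)%:R + 'X * eulerian_poly m.
pose b' m := (-1) ^+ m * b m.
pose c j := (-1) ^+ j * binom_eulerian_poly j.
have cE : c =1 binom_transform (-1) b'.
  by move=> j; rewrite /c binom_eulerian_transform binom_transform_sign.
have X1 : 1 - 'X != 0 :> {poly int} 
  by rewrite subr_eq0; apply/eqP => /(congr1 (size \o polyseq)); rewrite /= size_polyX size_poly1.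
apply: (mulfI X1).
transitivity (binom_transform 1 c k - 'X * binom_transform 'X c k).
  rewrite /binom_transform !mulr_sumr -sumrB; apply: eq_bigr => j _.
  rewrite !mulrnAr -mulrnBl; congr (_ *+ _); rewrite expr1n mulr1.
  have -> : \poly_(l < (k - j).+1) 1 = \sum_(l < (k - j).+1) 'X^l :> {poly int}.
    by rewrite poly_def; apply: eq_bigr => l _; rewrite scale1r.
  have := subrX1 ('X : {poly int}) (k - j).+1.
  rewrite exprS -/(c j) => E; rewrite -[RHS](_ : - ('X * 'X^(k - j) - 1) * c j = _); last ring.
  by rewrite E; ring.
rewrite !(eq_binom_transform _ _ cE) !binom_transform_comp subrr binom_transform0.
have -> : binom_transform ('X - 1) b' k = (-1) ^+ k * eulerian_poly k.
  rewrite -[X in binom_transform X]opprK -binom_transform_sign; congr (_ * _).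
  rewrite opprB binom_transformD !binom_transformZ binom_transform_delta.
  by rewrite -exprS -eulerian_poly_binom.
rewrite /b' /b; case: k => [|k]; rewrite ?eqxx /=; ring.
Qed.

(** * Degree bounds and the value at 1 *)

Lemma size_eulerian_poly k : (size (eulerian_poly k.+1) <= k.+1)%N.
Proof.
apply: (leq_trans (size_sum _ _ _)); apply/bigmax_leqP => s _; rewrite size_polyXn ltnS desE.
by rewrite -[leqRHS]card_ord -sum1_card leq_sum // => i _; case: (_ < _)%N.
Qed.

Lemma size_binom_eulerian_poly k : (size (binom_eulerian_poly k) <= k.+1)%N.
Proof.
apply: (leq_trans (size_polyD _ _)); rewrite geq_max size_poly1 /= big_add1 big_mkord /=.
rewrite mulr_sumr; apply: (leq_trans (size_sum _ _ _)); apply/bigmax_leqP => m _.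
rewrite mulrnAr -scaler_nat; apply: (leq_trans (size_scale_leq _ _)).
rewrite mulrC; have [->|nz] := eqVneq (eulerian_poly m.+1) 0; first by rewrite mul0r size_poly0.
by rewrite size_mulX // ltnS (leq_trans (size_eulerian_poly m)).
Qed.

(** At [t = 1] the Eulerian polynomial counts all [m!] permutations, and [C(k, m) m!] is the falling
    factorial. *)
Lemma binom_eulerian_poly_at1 k :
  (binom_eulerian_poly k).[1] = 1 + \sum_(1 <= m < k.+1) (k ^_ m)%:Z.
Proof.
rewrite /binom_eulerian_poly hornerD hornerM hornerX hornerC mul1r horner_sum; congr (_ + _).
apply: eq_bigr => m _; rewrite hornerMn -bin_ffact.
rewrite /eulerian_poly horner_sum (eq_bigr (fun=> 1)) => [|s _]; last first.
  by rewrite hornerXn expr1n.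
by rewrite sumr_const card_Sn -mulrnA mulnC -natz.
Qed.

(** * Moebius functions and finite sums *)

(** The vanishing sums over intervals force the values, by induction on the number of elements below
    [y]; a guessed formula then only has to satisfy them. *)
Lemma mobius_unique (d : Order.disp_t) (P : finPOrderType d) (x : P) (g : P -> int) :
  g x = 1 ->
  (forall y, (x < y)%O -> \sum_(z : P | (x <= z)%O && (z <= y)%O) g z = 0) ->
  forall y, (x <= y)%O -> mobius x y = g y.
Proof.
move=> gx1 gsum y; have [k] := ubnP #|[pred w | (w < y)%O]|.
elim: k y => // k IH y le_k xy; rewrite mobiusE; have [<-//|nxy] := eqVneq x y.
have lt_xy : (x < y)%O by rewrite lt_neqAle nxy.
rewrite lt_xy (eq_bigr g) => [|z /andP[xz zy]].
  have := gsum y lt_xy; rewrite (bigD1 y) ?xy ?lexx //= => /eqP.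
  rewrite addr_eq0 => /eqP ->; congr (- _); apply: eq_bigl => z.
  by rewrite -andbA [(z <= y)%O && _]andbC -lt_neqAle.
apply: IH => //; rewrite ltnS in le_k; apply: leq_trans le_k.
apply: proper_card; apply/properP; split.
  by apply/subsetP => v; rewrite !inE => /lt_trans; apply.
by exists z; rewrite !inE ?ltxx.
Qed.

Lemma sum_subset_card (R : nmodType) (T : finType) (E : {set T}) (F : nat -> R) :
  \sum_(A : {set T} | A \subset E) F #|A| = \sum_(j < #|E|.+1) F j *+ 'C(#|E|, j).
Proof.
rewrite (partition_big (fun A : {set T} => inord #|A| : 'I_#|E|.+1) predT) //=.
apply: eq_bigr => j _; rewrite -cards_draws -sumr_const.
apply: eq_big => [A|A /andP[AE /eqP <-]]; last by rewrite inordK // ltnS subset_leq_card.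
rewrite inE; have [AE|//] := boolP (A \subset E).
by rewrite -val_eqE /= inordK // ltnS subset_leq_card.
Qed.

(** The window [w - i <= v <= w] is the range of central weights below weight [w] when [i] leaves
    are absorbed; [v < j.+1] is the weight bound of a block with [j] leaves. *)
Lemma coef_mul_geom (p : {poly int}) (j i w N : nat) :
  (size p <= j.+1)%N -> (w < N)%N ->
  (p * \poly_(l < i.+1) 1)`_w =
  \sum_(v < N | [&& v < j.+1, v <= w & w <= v + i]%N) p`_v.
Proof.
move=> sz wN; rewrite coefM (big_ord_widen N (fun v => p`_v * _`_(w - v))) //.
rewrite big_mkcond [RHS]big_mkcond; apply: eq_bigr => v _ /=.
rewrite coef_poly ltnS; case: (leqP v w) => [vw|_]; last by rewrite andbF.
rewrite ltnS leq_subLR /=; have [vj|vj] := ltnP v j.+1.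
  by rewrite /=; case: ifP; rewrite ?mulr1 ?mulr0.
by rewrite nth_default ?mul0r //; apply: leq_trans vj.
Qed.

(** * Weighted bonds of the star *)

Section StarBonds.
Variable m : nat.
Local Notation T := 'I_m.+1.
Local Notation G := (star m.+1).
Implicit Types (b c d : wblock T) (z : wbond G).

Definition valid_center c : bool := (ord0 \in c.1) && (c.2 < #|c.1|)%N.

Definition star_blocks c : {set wblock T} :=
  c |: [set ([set x], ord0) | x in ~: c.1].

Lemma mem_star_blocks c b :
  b \in star_blocks c -> b = c \/ exists2 x, x \notin c.1 & b = ([set x], ord0).
Proof.
rewrite !inE => /orP[/eqP|/imsetP[x]]; first by left.
by rewrite inE; right; exists x.
Qed.

Lemma star_blocks_center c : c \in star_blocks c.
Proof. exact: setU11. Qed.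

Lemma star_blocks_leaf c x : x \notin c.1 -> ([set x], ord0) \in star_blocks c.
Proof. by move=> xc; rewrite inE orbC imset_f ?inE. Qed.

Lemma star_blocks_is_wpart c : valid_center c -> is_wpart (star_blocks c).
Proof.
case/andP=> c0 c2.
have uniq b b' x : b \in star_blocks c -> b' \in star_blocks c ->
    x \in b.1 -> x \in b'.1 -> b = b'.
  case/mem_star_blocks=> [->|[y yc ->]] /mem_star_blocks[->|[y' yc' ->]] //=;
    rewrite ?inE.
  - by move=> xc /eqP xy; rewrite -xy xc in yc'.
  - by move=> /eqP xy xc; rewrite -xy xc in yc.
  - by move=> /eqP <- /eqP <-.
have lt b : b \in star_blocks c -> (b.2 < #|b.1|)%N.
  by case/mem_star_blocks=> [->//|[y _ ->]] /=; rewrite cards1.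
have ex b : b \in star_blocks c -> exists x, x \in b.1.
  by move/lt => h; apply/card_gt0P; apply: leq_ltn_trans h.
apply/and3P; split; last by apply/forall_inP.
- apply/and3P; split.
  + apply/eqP/setP => x; rewrite inE; apply/bigcupP.
    have [xc|xc] := boolP (x \in c.1).
      by exists c.1 => //; apply: imset_f; apply: star_blocks_center.
    exists [set x]; last exact: set11.
    by apply/imsetP; exists ([set x], ord0) => //; apply: star_blocks_leaf.
  + apply/trivIsetP => _ _ /imsetP[b bc ->] /imsetP[b' bc' ->].
    apply: contraNT => /pred0Pn[x /andP[xb xb']].
    by rewrite (uniq _ _ _ bc bc' xb xb').
  + by apply/imsetP => -[b /ex[x xb] E]; rewrite -E inE in xb.
- apply/forall_inP => b bc; apply/forall_inP => b' bc'; apply/implyP => /eqP E.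
  by have [x xb] := ex _ bc; apply/eqP/(uniq _ _ x) => //; rewrite -E.
Qed.

Lemma induces_connected_star (B : {set T}) : ord0 \in B -> induces_connected G B.
Proof.
move=> B0; apply/forall_inP => x xB; apply/forall_inP => y yB.
set e := [rel u v | _].
have H0 u v : u \in B -> v \in B -> (u == ord0) || (v == ord0) -> connect e u v.
  move=> uB vB; have [->|nuv] := eqVneq u v; first by rewrite connect0.
  by move=> h; apply: connect1; rewrite /e /= uB vB /star_adj nuv.
by apply: (@connect_trans _ e ord0); apply: H0; rewrite ?eqxx ?orbT.
Qed.

(** Every edge of the star meets the centre, so the first edge of a path inside [B] would put [ord0]
    in [B]. *)
Lemma induces_connected_leaves (B : {set T}) x :
  induces_connected G B -> ord0 \notin B -> x \in B -> B = [set x].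
Proof.
move=> /forall_inP conn B0 xB; apply/setP => y; rewrite inE.
apply/idP/eqP => [yB|->//].
have /forall_inP/(_ y yB)/connectP[[|u p] /= pth ->//] := conn x xB.
case/andP: pth => /and3P[_ uB /andP[_ /orP[]/eqP v0]].
  by rewrite (_ : ord0 = x) ?xB // in B0; apply: val_inj.
by rewrite (_ : ord0 = u) ?uB // in B0; apply: val_inj.
Qed.

Lemma star_blocks_wbond c (h : valid_center c) :
  is_wbond G (WPart (star_blocks_is_wpart h)).
Proof.
apply/forall_inP => b /mem_star_blocks[->|[x _ ->]].
  by apply: induces_connected_star; case/andP: h.
apply/forall_inP => y; rewrite inE => /eqP->.
by apply/forall_inP => z; rewrite inE => /eqP->; rewrite connect0.
Qed.

Definition center z : wblock T :=
  odflt (set0, ord0) [pick b in wblocks z | ord0 \in b.1].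

Lemma centerP z : center z \in wblocks z /\ ord0 \in (center z).1.
Proof.
rewrite /center; case: pickP => [b /andP[]//|no].
by have [b bz b0] := wpart_cover z ord0; have := no b; rewrite bz b0.
Qed.

Lemma centerE z b : b \in wblocks z -> ord0 \in b.1 -> center z = b.
Proof. by have [cz c0] := centerP z => bz b0; apply: wpart_uniq cz bz c0 b0. Qed.

Lemma center_valid z : valid_center (center z).
Proof. by have [cz c0] := centerP z; rewrite /valid_center c0 (wpart_lt cz). Qed.

(** A block avoiding the centre is a singleton by connectedness, and a weight below 1 is 0. *)
Lemma wbond_starE z : wblocks z = star_blocks (center z).
Proof.
have [cz c0] := centerP z.
have leaf b x : b \in wblocks z -> x \in b.1 -> x \notin (center z).1 -> b = ([set x], ord0).
  move=> bz xb xc; have b1 : b.1 = [set x].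
    apply: induces_connected_leaves => //; first by have /forall_inP/(_ b bz) := wbondP z.
    by apply: contra xc => b0; rewrite (centerE bz b0).
  have := wpart_lt bz; rewrite b1 cards1 ltnS leqn0 => /eqP b2.
  by case: b b1 b2 {bz xb} => B v /= -> v0; congr (_, _); apply: val_inj.
apply/setP => b; apply/idP/idP => [bz|/mem_star_blocks[->//|[x xc ->]]].
  have [->|nbc] := eqVneq b (center z); first exact: star_blocks_center.
  have [x xb] := wpart_ex bz.
  have xc : x \notin (center z).1.
    by apply: contra nbc => xc; apply/eqP; apply: wpart_uniq bz cz xb xc.
  by rewrite (leaf b x) // star_blocks_leaf.
by have [b' bz xb] := wpart_cover z x; rewrite -(leaf b' x).
Qed.

(** The bottom element serves as default, making the map total on pairs. *)
Definition star_bond c : wbond G :=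
  insubd (wbond_bot G) (insubd (wbond_part (wbond_bot G)) (star_blocks c)).

Lemma star_bondE c : valid_center c -> wblocks (star_bond c) = star_blocks c.
Proof.
move=> h; have E : insubd (wbond_part (wbond_bot G)) (star_blocks c) =
    WPart (star_blocks_is_wpart h).
  by apply: val_inj; rewrite insubdK //; exact: star_blocks_is_wpart h.
rewrite /star_bond E insubdK //; exact: star_blocks_wbond.
Qed.

(** The left side is the condition produced by reindexing a sum over bonds along [star_bond]. *)
Lemma center_star_bond c : (center (star_bond c) == c) = valid_center c.
Proof.
apply/eqP/idP => [<-|h]; first exact: center_valid.
by apply: centerE; rewrite ?star_bondE ?star_blocks_center //; case/andP: h.
Qed.

Lemma star_bondK z : star_bond (center z) = z.
Proof.
do 2 apply: val_inj; rewrite /= star_bondE ?center_valid //.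
by rewrite -wbond_starE.
Qed.

Lemma weight_in_star c (D : {set T}) : c.1 \subset D -> weight_in (star_blocks c) D = c.2.
Proof.
move=> cD; rewrite /weight_in (bigD1 c) /= ?star_blocks_center //.
rewrite big1 ?addn0 // => b /andP[/andP[/mem_star_blocks[->|[x _ ->]]]]//.
by rewrite eqxx.
Qed.

Lemma nblocks_in_star c (D : {set T}) : valid_center c -> c.1 \subset D ->
  nblocks_in (star_blocks c) D = #|D :\: c.1|.+1.
Proof.
move=> /andP[c0 _] cD; rewrite /nblocks_in.
have -> : [set a in star_blocks c | a.1 \subset D] =
    c |: [set ([set x], ord0) | x in D :\: c.1].
  apply/setP => b; rewrite in_set [RHS]in_setU1; apply/andP/orP.
    case=> /mem_star_blocks[->|[x xc ->]]; first by rewrite eqxx; left.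
    by rewrite sub1set => xD; right; apply: imset_f; rewrite !inE xc.
  case=> [/eqP->|/imsetP[x]]; first by rewrite star_blocks_center.
  by rewrite inE => /andP[xc xD] ->; rewrite sub1set xD star_blocks_leaf.
rewrite cardsU1 card_imset ?add1n => [|x y [] /set1_inj //].
case: imsetP => //= -[x xc E]; move: xc.
by rewrite inE E set11.
Qed.

(** Only the central block of [d] gives a condition on weights: it merges the central block of [c]
    with one singleton per new leaf. The other blocks of [d] are unchanged singletons. *)
Lemma star_bond_le c d : valid_center c -> valid_center d ->
  (star_bond c <= star_bond d)%O =
  (c.1 \subset d.1) && (c.2 <= d.2 <= c.2 + #|d.1 :\: c.1|)%N.
Proof.
move=> hc hd; have /andP[c0 _] := hc; have /andP[d0 _] := hd.
rewrite -[LHS]/(wpart_le (star_bond c) (star_bond d)).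
apply/wpart_leP/andP; rewrite !star_bondE //.
  case=> H1 H2; have cd : c.1 \subset d.1.
    have [b /mem_star_blocks[->//|[x xd ->]]] := H1 c (star_blocks_center c).
    by move=> /subsetP/(_ _ c0); rewrite inE => /eqP x0; rewrite -x0 d0 in xd.
  have := H2 d (star_blocks_center d).
  by rewrite weight_in_star // nblocks_in_star // addnS ltnS.
case=> cd wcd; split=> b /mem_star_blocks[->|[x xc ->]].
- by exists d; rewrite ?star_blocks_center.
- have [xd|xd] := boolP (x \in d.1).
    by exists d; rewrite ?star_blocks_center ?sub1set.
  by exists ([set x], ord0); rewrite ?star_blocks_leaf.
- by rewrite weight_in_star // nblocks_in_star // addnS ltnS.
have xc' : x \notin c.1 by apply: contra xc => /(subsetP cd).
have mem a : (a \in star_blocks c) && (a.1 \subset [set x]) = (a == ([set x], ord0)).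
  apply/andP/eqP => [[/mem_star_blocks[->|[y _ ->]]]|->] /=.
  - by move=> /subsetP/(_ _ c0); rewrite inE => /eqP x0; rewrite -x0 c0 in xc'.
  - by rewrite sub1set inE => /eqP->.
  - by rewrite star_blocks_leaf.
rewrite /weight_in (eq_bigl _ _ mem) big_pred1_eq /nblocks_in.
by rewrite (eq_card (B := pred1 ([set x], ord0))) ?card1 // => a; rewrite inE mem.
Qed.

Lemma center_bot : center (wbond_bot G) = ([set ord0], ord0).
Proof. by apply: centerE; rewrite /= ?set11 // imset_f. Qed.

(** The candidate Moebius value; [k] is the number of leaves in the central block. *)
Definition star_mobius z : int :=
  let c := center z in let k := #|c.1|.-1 in ((-1) ^+ k * binom_eulerian_poly k)`_c.2.

(** For a fixed leaf set, summing over the weights gives a coefficient of a product with a geometric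
    sum; grouping leaf sets by size then gives a coefficient of the left side of
    [binom_eulerian_inversion]. *)
Lemma star_mobius_sum y : (wbond_bot G < y)%O ->
  \sum_(z : wbond G | (wbond_bot G <= z)%O && (z <= y)%O) star_mobius z = 0.
Proof.
rewrite lt_neqAle => /andP[ny _].
set d := center y; have hd : valid_center d := center_valid y.
have /andP[d0 d2] := hd.
set E := d.1 :\ ord0; have dE : #|d.1| = #|E|.+1 by rewrite (cardsD1 ord0) d0.
(* Without leaves the central block is the centre alone with weight 0, so [y] would be the
   bottom. *)
have E0 : #|E| != 0%N.
  apply: contra ny => /eqP E0; rewrite -(star_bondK (wbond_bot G)) -(star_bondK y).
  have -> // : center (wbond_bot G) = center y.
  move: d2; rewrite center_bot -/d dE E0 ltnS leqn0 => /eqP w0.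
  have /cards1P[x dx] : #|d.1| == 1%N by rewrite dE E0.
  move: d0; rewrite dx inE => /eqP x0.
  by case: (d) dx w0 => D w /= -> w0; rewrite x0; congr (_, _); apply: val_inj.
pose g j : {poly int} := (-1) ^+ j * binom_eulerian_poly j.
have size_g j : (size (g j) <= j.+1)%N.
  by rewrite /g -signr_odd mulr_sign; case: ifP; rewrite ?size_polyN size_binom_eulerian_poly.
transitivity ((\sum_(j < #|E|.+1) (g j * \poly_(l < (#|E| - j).+1) 1) *+ 'C(#|E|, j))`_d.2);
  last by rewrite binom_eulerian_inversion (negPf E0) coef0.
rewrite -(sum_subset_card E (fun j => g j * \poly_(l < (#|E| - j).+1) 1)) coef_sum.
rewrite (reindex_onto star_bond center) => [|z _]; last exact: star_bondK.
rewrite (eq_bigl (fun c => [&& ord0 \in c.1, c.1 \subset d.1 &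
    [&& c.2 < #|c.1|, c.2 <= d.2 & d.2 <= c.2 + #|d.1 :\: c.1|]%N])); last first.
  move=> c; rewrite wbond_bot_le center_star_bond andbC /=.
  case hc: (valid_center c); last first.
    by move: hc; rewrite /valid_center; case: (ord0 \in _) => //= ->; rewrite andbF.
  by rewrite -[y]star_bondK star_bond_le //; case/andP: hc => -> ->.
rewrite (eq_bigr (fun c => (g #|c.1|.-1)`_c.2)); last first.
  move=> c /and3P[c0 _ /and3P[c2 _ _]]; rewrite /star_mobius.
  by have /eqP -> : center (star_bond c) == c by rewrite center_star_bond /valid_center c0.
under eq_bigl => c do rewrite andbA.
rewrite -(pair_big_dep (fun B : {set T} => (ord0 \in B) && (B \subset d.1))
  (fun B (v : 'I__) => [&& v < #|B|, v <= d.2 & d.2 <= v + #|d.1 :\: B|]%N)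
  (fun B v => (g #|B|.-1)`_v)) /=.
(* Central blocks are replaced by their leaf sets, which range over the subsets of [E]. *)
rewrite (reindex_onto (fun A : {set T} => ord0 |: A) (fun B => B :\ ord0)); last first.
  by move=> B /andP[B0 _]; rewrite setD1K.
apply: eq_big => [A|A]; rewrite setU11 /=.
  rewrite subUset sub1set d0 /= /E subsetD1; congr andb.
  apply/eqP/idP => [<-|A0]; first by rewrite !inE eqxx.
  by rewrite setU1K.
case/andP=> AD /eqP AE.
have A0 : ord0 \notin A by rewrite -AE !inE eqxx.
have AsE : A \subset E by rewrite /E subsetD1 A0 andbT; apply: subset_trans AD; exact: subsetUr.
rewrite (coef_mul_geom _ (size_g _) (ltn_ord d.2)) cardsU1 A0 /=.
by rewrite (_ : #|d.1 :\: _| = #|E| - #|A|)%N // -setDDl -/E cardsDS.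
Qed.

Lemma mobius_starE z : mobius (wbond_bot G) z = star_mobius z.
Proof.
apply: mobius_unique; last exact: wbond_bot_le.
  rewrite /star_mobius center_bot cards1 /= mul1r /binom_eulerian_poly big_geq //.
  by rewrite mulr0 addr0 coef1.
exact: star_mobius_sum.
Qed.

End StarBonds.

(** The central block of [V^j] has all [m] leaves, so the Moebius values are the coefficients of one
    polynomial; its degree is at most [m], so none is missed. *)
Lemma star_mobius_poly (m : nat) (h : (0 < m.+1)%N) :
  mobius_poly (star_connected h) = (-1) ^+ m * binom_eulerian_poly m.
Proof.
rewrite /mobius_poly.
rewrite (eq_bigr (fun j : 'I_#|'I_m.+1| => ((-1) ^+ m * binom_eulerian_poly m)`_j *: 'X^j)).
  rewrite -(poly_def _ (fun j => ((-1) ^+ m * binom_eulerian_poly m)`_j)) card_ord.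
  apply/polyP => j; rewrite coef_poly; case: ltnP => // mj; rewrite nth_default //.
  apply: leq_trans mj; rewrite -signr_odd mulr_sign.
  by case: ifP; rewrite ?size_polyN size_binom_eulerian_poly.
move=> j _; rewrite mobius_starE /star_mobius; congr (_ *: _).
have -> : center (wbond_top (star_connected h) j) = ([set: 'I_m.+1], widen_ord (leqnSn _) j).
  by apply: centerE; rewrite /= ?inE.
by have -> : #|[set: 'I_m.+1]| = m.+1 by rewrite cardsT card_ord.
Qed.

Theorem theorem3p3 (n : nat) (hn : (0 < n)%N) :
  (-1) ^+ n.-1 * mobius_poly (star_connected hn) = binom_eulerian_poly n.-1
  /\ (-1) ^+ n.-1 * (mobius_poly (star_connected hn)).[1]
     = 1 + \sum_(1 <= m < n) ((n.-1) ^_ m)%:Z.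
Proof.
case: n hn => // m h; rewrite star_mobius_poly /=.
split; first by rewrite mulrA -expr2 sqrr_sign mul1r.
rewrite -binom_eulerian_poly_at1 hornerM horner_exp hornerN hornerC.
by rewrite mulrA -expr2 sqrr_sign mul1r.
Qed.
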